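(* Let $t_1=\partial_x$, $t_2=x\,\partial_y+\partial_\theta$, $t_3=\partial_y$ on $N=\mathbb R^3$ with coordinates $(x,y,\theta)$, and let $t_b=b_1t_1+b_2t_2+b_3t_3$ with $b_1,b_2,b_3\in\mathbb R$. The action of the flow of the infinitesimal transformation $t_b$ at time $s$ maps a local extremal corresponding to a local minimizer with initial condition $x(0)=y(0)=\theta(0)=0$ to another local extremal with the same vertical part, whose horizontal part corresponds to a local minimizer with initial condition $$x(0)=b_1s,\qquad y(0)=\tfrac12b_2b_1s^2+b_3s,\qquad \theta(0)=b_2s .$$
   Context: On $N=\mathbb R^3$ consider the left-invariant sub-Riemannian structure $(N,\mathcal N,r)$, where $\mathcal N=\langle n_1,n_2\rangle$, $n_1=\partial_\theta$, $n_2=\partial_x+\theta\,\partial_y$, and $n_1,n_2$ are orthonormal for $r=dx^2+d\theta^2$; put $n_3=[n_1,n_2]=\partial_y$. The group law on $N$, in the coordinate order $(\theta,x,y)$, is $(\theta,x,y)\circ(\tilde\theta,\tilde x,\tilde y)=(\theta+\tilde\theta,x+\tilde x,y+\tilde y+\theta\tilde x)$. Let $h_i(f)=\langle f,n_i\rangle$, $i=1,2,3$, be the vertical coordinates on $T^*N$. A local extremal is a (normal) extremal, i.e. a curve in $T^*N$ with coordinates $(x,y,\theta,h_1,h_2,h_3)$ solving $$\dot h_1=-h_3h_2,\quad \dot h_2=h_3h_1,\quad \dot h_3=0,\qquad \dot x=h_2,\quad \dot y=\theta h_2,\quad \dot\theta=h_1 .$$ Its vertical part is $(h_1,h_2,h_3)(t)$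 and its horizontal part is the projection $(x,y,\theta)(t)$ to $N$. A local minimizer means the projection to $N$ of such an extremal. The flow of $t_b$ acts on $T^*N$ by the natural (cotangent) lift. *)

(* Defs.v *)
From mathcomp Require Import all_boot all_order all_algebra.
From mathcomp Require Import all_classical all_reals all_analysis.

Set Implicit Arguments.
Unset Strict Implicit.
Unset Printing Implicit Defensive.

Import Order.TTheory GRing.Theory Num.Theory.
Import numFieldNormedType.Exports.

Local Open Scope classical_set_scope.
Local Open Scope ring_scope.

(* Points of N = R^3 and, N being trivialised by its global chart, also its
   tangent vectors.  The coordinate order is (x, y, theta). *)
Notation space R := 'rV[R]_3 (only parsing).

Definition vec3 (R : realType) (x y theta : R) : space R :=
  \row_(i < 3) [:: x; y; theta]`_i.

Definition xco (R : realType) (q : space R) : R := q 0 0.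
Definition yco (R : realType) (q : space R) : R := q 0 1.
Definition thetaco (R : realType) (q : space R) : R := q 0 2.

Definition dx (R : realType) : space R := vec3 1 0 0.
Definition dy (R : realType) : space R := vec3 0 1 0.
Definition dtheta (R : realType) : space R := vec3 0 0 1.
Arguments dx {R}.
Arguments dy {R}.
Arguments dtheta {R}.

Definition vector_field (R : realType) := space R -> space R.

Definition n1 (R : realType) : vector_field R := fun _ => dtheta.
Definition n2 (R : realType) : vector_field R :=
  fun q => dx + thetaco q *: dy.
(* n3 = [n1, n2] *)
Definition n3 (R : realType) : vector_field R := fun _ => dy.

Definition t1 (R : realType) : vector_field R := fun _ => dx.
Definition t2 (R : realType) : vector_field R :=
  fun q => xco q *: dy + dtheta.
Definition t3 (R : realType) : vector_field R := fun _ => dy.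

Definition tb (R : realType) (b1 b2 b3 : R) : vector_field R :=
  fun q => b1 *: t1 q + b2 *: t2 q + b3 *: t3 q.

(* T^*N = N x (R^3)^*, an element being a base point together with a covector.
   Covectors are columns, so that they pair with (row) tangent vectors by the
   matrix product. *)
Notation cotangent R := ('rV[R]_3 * 'cV[R]_3)%type (only parsing).

Definition pairing (R : realType) (p : 'cV[R]_3) (v : 'rV[R]_3) : R :=
  (v *m p) 0 0.

Definition vertical_coord (R : realType) (n : vector_field R)
    (f : cotangent R) : R :=
  pairing f.2 (n f.1).

Definition h1 (R : realType) (f : cotangent R) : R := vertical_coord (@n1 R) f.
Definition h2 (R : realType) (f : cotangent R) : R := vertical_coord (@n2 R) f.
Definition h3 (R : realType) (f : cotangent R) : R := vertical_coord (@n3 R) f.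

Definition vertical_part (R : realType) (f : cotangent R) : R * R * R :=
  (h1 f, h2 f, h3 f).

Definition horizontal_part (R : realType) (f : cotangent R) : space R := f.1.

(* f has derivative v at t relatively to J: the usual derivative at interior
   points of J, the one-sided derivative at endpoints belonging to J. *)
Definition has_deriv_in (R : realType) (J : interval R) (f : R -> R)
    (t v : R) : Prop :=
  (f u - f t) / (u - t) @[u --> within [set` J] t^'] --> v.

(* Curves are total functions on R, of which only the restriction to the
   interval J matters. *)
Definition local_extremal (R : realType) (J : interval R)
    (lam : R -> cotangent R) : Prop :=
  forall t, t \in J ->
    let f := lam t in
    [/\ has_deriv_in J (fun u => h1 (lam u)) t (- h3 f * h2 f),
        has_deriv_in J (fun u => h2 (lam u)) t (h3 f * h1 f)
      & has_deriv_in J (fun u => h3 (lam u)) t 0] /\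
    [/\ has_deriv_in J (fun u => xco (horizontal_part (lam u))) t (h2 f),
        has_deriv_in J (fun u => yco (horizontal_part (lam u))) t
          (thetaco (horizontal_part f) * h2 f)
      & has_deriv_in J (fun u => thetaco (horizontal_part (lam u))) t (h1 f)].

Definition local_minimizer (R : realType) (J : interval R)
    (gam : R -> space R) : Prop :=
  exists2 lam : R -> cotangent R, local_extremal J lam &
    forall t, t \in J -> gam t = horizontal_part (lam t).

Definition is_flow (R : realType) (V : vector_field R)
    (phi : R -> space R -> space R) : Prop :=
  forall q, phi 0 q = q /\
    forall s : R, is_derive s 1 (fun u : R => phi u q) (V (phi s q)).

(* The global flow of V; it is the identity at all times when V has none. *)
Definition flow (R : realType) (V : vector_field R) :
    R -> space R -> space R :=
  @xget (R -> space R -> space R) (fun _ q => q) [set phi | is_flow V phi].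

(* The covector p at q is sent to p o (d_q F)^-1 at F q.  As 'J F q acts on the
   right of tangent rows, its inverse acts on the left of covector columns. *)
Definition cotangent_lift (R : realType) (F : space R -> space R)
    (f : cotangent R) : cotangent R :=
  (F f.1, invmx ('J F f.1) *m f.2).

(* Main.v *)
Require Import Defs.
From mathcomp Require Import all_boot all_order all_algebra.
From mathcomp Require Import all_classical all_reals all_analysis.
From mathcomp Require Import ring.

Import Order.TTheory GRing.Theory Num.Theory.
Import numFieldNormedType.Exports.

Local Open Scope ring_scope.

(** The fields [t1], [t2], [t3] are the right-invariant fields of the group
    [N]: their flows are the left translations.  Explicitly, the flow of [tb]
    is the affine map
    [(x, y, theta) |-> (x + b1 s, y + b2 s x + b1 b2 s^2/2 + b3 s, theta + b2 s)],
    obtained by integrating [x' = b1], [theta' = b2] and then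
    [y' = b2 x + b3]; evaluating it at the origin gives the asserted initial
    condition.  Left translations preserve the left-invariant frame [n1], [n2],
    [n3] ([shear_n1], [shear_n2], [shear_n3]), so their cotangent lifts preserve
    the vertical coordinates [h1], [h2], [h3] at every covector
    ([vertical_part_lift_flow]).  The vertical equations are thus
    unchanged.  In the horizontal ones, [x] and [theta] are translated by
    constants, while [y] gets the extra term [b2 s x], whose derivative
    [b2 s h2] is exactly what the change of [theta] to [theta + b2 s] adds to
    [theta h2]. *)

(** * Coordinates *)

Section Coordinates.
Variable R : realType.
Implicit Types (q v w : 'rV[R]_3) (x y z c : R).

Lemma xco_vec3 x y z : xco (vec3 x y z) = x. Proof. by rewrite /xco mxE. Qed.

Lemma yco_vec3 x y z : yco (vec3 x y z) = y. Proof. by rewrite /yco mxE. Qed.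

Lemma thetaco_vec3 x y z : thetaco (vec3 x y z) = z.
Proof. by rewrite /thetaco mxE. Qed.

Lemma ord3P (P : 'I_3 -> Prop) : P 0 -> P 1 -> P 2 -> forall i, P i.
Proof.
move=> P0 P1 P2 [[|[|[|//]]] lti].
- by rewrite (_ : Ordinal lti = 0) //; apply: val_inj.
- by rewrite (_ : Ordinal lti = 1) //; apply: val_inj.
- by rewrite (_ : Ordinal lti = 2) //; apply: val_inj.
Qed.

Lemma space_ext q q' :
  xco q = xco q' -> yco q = yco q' -> thetaco q = thetaco q' -> q = q'.
Proof. by move=> ex ey et; apply/rowP; apply: ord3P. Qed.

Lemma vec3_eta q : q = vec3 (xco q) (yco q) (thetaco q).
Proof. by apply: space_ext; rewrite ?xco_vec3 ?yco_vec3 ?thetaco_vec3. Qed.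

Lemma vec3D x y z x' y' z' :
  vec3 x y z + vec3 x' y' z' = vec3 (x + x') (y + y') (z + z').
Proof. by apply/rowP; apply: ord3P; rewrite !mxE. Qed.

Lemma vec3Z c x y z : c *: vec3 x y z = vec3 (c * x) (c * y) (c * z).
Proof. by apply/rowP; apply: ord3P; rewrite !mxE. Qed.

Lemma n2E q : n2 q = vec3 1 (thetaco q) 0.
Proof. by rewrite /n2 /dx /dy vec3Z vec3D !mulr0 !mulr1 !addr0 add0r. Qed.

Lemma tbE b1 b2 b3 q : tb b1 b2 b3 q = vec3 b1 (b2 * xco q + b3) b2.
Proof.
rewrite /tb /t1 /t2 /t3 /dx /dy /dtheta !vec3Z !vec3D !vec3Z !vec3D.
by congr vec3; ring.
Qed.

End Coordinates.

(** * Differentiation of row-valued curves and of affine maps *)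

Lemma is_derive_mxP (R : realFieldType) (V : normedModType R) (m n : nat)
    (M : V -> 'M[R]_(m, n)) (t v : V) (dM : 'M[R]_(m, n)) :
  is_derive t v M dM <->
  forall i j, is_derive t v (fun u => M u i j) (dM i j).
Proof.
split=> [[dvM <-] i j | dvM].
  move/derivable_mxP: (dvM) => /(_ i j) dvMij.
  by split=> //; rewrite derive_mx// mxE.
have ex : derivable M t v by apply/derivable_mxP => i j; case: (dvM i j).
split=> //; rewrite derive_mx//; apply/matrixP => i j.
by rewrite mxE; case: (dvM i j).
Qed.

Lemma is_derive_vec3P (R : realType) (q : R -> 'rV[R]_3) (t : R)
    (x y z : R) :
  is_derive t 1 q (vec3 x y z) <->
  [/\ is_derive t 1 (fun u => xco (q u)) x,
      is_derive t 1 (fun u => yco (q u)) y &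
      is_derive t 1 (fun u => thetaco (q u)) z].
Proof.
split=> [/is_derive_mxP dq|[dqx dqy dqz]].
  by split; [have := dq 0 0|have := dq 0 1|have := dq 0 2]; rewrite mxE.
by apply/is_derive_mxP => i; rewrite ord1; apply: ord3P; rewrite mxE.
Qed.

Lemma eq_of_is_derive {R : realType} (df f g : R -> R) :
  f 0 = g 0 -> (forall t : R, is_derive t 1 f (df t)) ->
  (forall t : R, is_derive t 1 g (df t)) -> f =1 g.
Proof.
move=> fg0 fd gd t; apply/eqP; rewrite -subr_eq0; apply/eqP.
have fg' (u : R) : is_derive u 1 (f - g) 0 by apply: is_derive_eq; rewrite subrr.
have := is_derive_0_is_cst t 0 fg'.
by rewrite -[LHS]/(f t - g t) -[RHS]/(f 0 - g 0) fg0 subrr.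
Qed.

(** The product is a sum of coordinates times fixed rows, and coordinates are
    differentiable. *)
Lemma differentiable_mulmxr {R : realFieldType} {m n : nat} (A : 'M[R]_(m, n))
    (q : 'rV[R]_m) :
  differentiable (mulmxr A : 'rV[R]_m -> 'rV[R]_n) q.
Proof.
have -> : (mulmxr A : 'rV[R]_m -> 'rV[R]_n) =
    \sum_i (fun x : 'rV[R]_m => x 0 i *: row i A).
  by apply/funext => x; rewrite /= mulmx_sum_row fct_sumE.
by apply: differentiable_sum => i; apply/differentiableZl/differentiable_coord.
Qed.

Lemma jacobian_affine (R : realFieldType) (m n : nat) (A : 'M[R]_(m, n))
    (c : 'rV[R]_n) (q : 'rV[R]_m) :
  'J (fun x : 'rV[R]_m => x *m A + c) q = A.
Proof.
have dA : is_diff q (mulmxr A : 'rV[R]_m -> 'rV[R]_n) (mulmxr A).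
  apply: DiffDef; first exact: differentiable_mulmxr.
  apply: diff_lin => x.
  exact: differentiable_continuous (differentiable_mulmxr A x).
have dF := is_diffD dA (is_diff_cst c q).
have diffF : 'd (fun x : 'rV[R]_m => x *m A + c) q = mulmxr A :> (_ -> _).
  by rewrite -[RHS]addr0; case: dF.
by apply/row_matrixP => i; rewrite !rowE mul_rV_lin1 diffF.
Qed.

(** * The flow of [tb] *)

Section Flow.
Variable R : realType.
Variables b1 b2 b3 : R.
Implicit Types (s : R) (q : 'rV[R]_3).

(** The linear part of the time-[s] flow of [tb], in terms of [c = b2 * s]. *)
Definition shear (c : R) : 'M[R]_3 := 1%:M + c *: delta_mx 0 1.

Lemma mul_vec3_shear x y z c :
  vec3 x y z *m shear c = vec3 x (y + c * x) z.
Proof.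
apply/rowP => i; rewrite mulmxDr mulmx1 -scalemxAr !mxE.
rewrite !big_ord_recl big_ord0 !mxE /=; move: i.
by apply: ord3P; rewrite /=; ring.
Qed.

(** Opposite shears are inverse to each other. *)
Lemma shear_unit c : shear c \in unitmx.
Proof.
suff: shear c *m shear (- c) = 1%:M by case/mulmx1_unit.
apply/row_matrixP => i; rewrite !rowE mulmxA mulmx1.
rewrite [delta_mx 0 i]vec3_eta !mul_vec3_shear.
by congr vec3; ring.
Qed.

(** Written as a linear map followed by a translation, so that its Jacobian can
    be read off. *)
Definition tb_flow s q : 'rV[R]_3 :=
  q *m shear (b2 * s) +
  vec3 (b1 * s) (2^-1 * b2 * b1 * s ^+ 2 + b3 * s) (b2 * s).

Lemma tb_flowE s q : tb_flow s q =
  vec3 (xco q + b1 * s)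
       (yco q + b2 * s * xco q + (2^-1 * b2 * b1 * s ^+ 2 + b3 * s))
       (thetaco q + b2 * s).
Proof. by rewrite /tb_flow {1}[q]vec3_eta mul_vec3_shear vec3D. Qed.

Lemma is_flow_tb_flow : is_flow (tb b1 b2 b3) (tb_flow).
Proof.
move=> q; split.
  rewrite tb_flowE [RHS]vec3_eta.
  by congr vec3; ring.
move=> s; rewrite tbE; apply/is_derive_vec3P.
under eq_fun do rewrite tb_flowE xco_vec3.
under [X in is_derive _ _ X (_ + b3)]eq_fun do rewrite tb_flowE yco_vec3.
under [X in is_derive _ _ X b2]eq_fun do rewrite tb_flowE thetaco_vec3.
split.
- by apply: is_derive_eq; rewrite /GRing.scale /=; ring.
- by apply: is_derive_eq; rewrite tb_flowE xco_vec3 /GRing.scale /=; field.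
- by apply: is_derive_eq; rewrite /GRing.scale /=; ring.
Qed.

(** The system is triangular: [x] and [theta] have constant speeds and
    the speed of [y] is a function of [x] alone, so integrating one coordinate
    at a time gives uniqueness without any Lipschitz argument. *)
Lemma is_flow_tb_unique (phi psi : R -> 'rV[R]_3 -> 'rV[R]_3) :
  is_flow (tb b1 b2 b3) phi -> is_flow (tb b1 b2 b3) psi -> phi = psi.
Proof.
move=> phiF psiF; apply/funext => s; apply/funext => q.
have [phi0 dphi] := phiF q; have [psi0 dpsi] := psiF q.
have eq0 : phi 0 q = psi 0 q by rewrite phi0 psi0.
have D f : (forall u : R, is_derive u 1 (f^~ q) (tb b1 b2 b3 (f u q))) ->
    forall u : R, [/\ is_derive u 1 (fun t => xco (f t q)) b1,
      is_derive u 1 (fun t => yco (f t q)) (b2 * xco (f u q) + b3) &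
      is_derive u 1 (fun t => thetaco (f t q)) b2].
  by move=> df u; apply/is_derive_vec3P; rewrite -tbE.
have {}dphi := D _ dphi; have {D}dpsi := D _ dpsi.
have eqx : (fun u => xco (phi u q)) =1 (fun u => xco (psi u q)).
  apply: (eq_of_is_derive (cst b1)) => [|u|u]; first by rewrite eq0.
    by case: (dphi u).
  by case: (dpsi u).
have eqy : (fun u => yco (phi u q)) =1 (fun u => yco (psi u q)).
  apply: (eq_of_is_derive (fun u => b2 * xco (phi u q) + b3)) => [|u|u].
  - by rewrite eq0.
  - by case: (dphi u).
  - by rewrite (eqx u); case: (dpsi u).
have eqtheta : (fun u => thetaco (phi u q)) =1 (fun u => thetaco (psi u q)).
  apply: (eq_of_is_derive (cst b2)) => [|u|u]; first by rewrite eq0.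
    by case: (dphi u).
  by case: (dpsi u).
exact: space_ext (eqx s) (eqy s) (eqtheta s).
Qed.

Lemma flow_tb : flow (tb b1 b2 b3) = tb_flow.
Proof.
apply: xget_unique; first exact: is_flow_tb_flow.
by move=> phi phiF; apply: is_flow_tb_unique phiF (is_flow_tb_flow).
Qed.

Lemma jacobian_tb_flow s q : 'J (tb_flow s) q = shear (b2 * s).
Proof. exact: jacobian_affine. Qed.

(** * Invariance of the frame and of the vertical coordinates *)

Lemma shear_n1 s q :
  n1 q *m shear (b2 * s) = n1 (tb_flow s q).
Proof. by rewrite mul_vec3_shear mulr0 addr0. Qed.

(** The only frame field that is not constant: the [y]-component that the shear
    adds to [dx] is the increment of [theta] along the flow. *)
Lemma shear_n2 s q :
  n2 q *m shear (b2 * s) = n2 (tb_flow s q).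
Proof. by rewrite !n2E tb_flowE thetaco_vec3 mul_vec3_shear mulr1. Qed.

Lemma shear_n3 s q :
  n3 q *m shear (b2 * s) = n3 (tb_flow s q).
Proof. by rewrite mul_vec3_shear mulr0 addr0. Qed.

(** Pairing with a covector is unchanged when the covector is transported by the
    cotangent lift of [F] and the vector by the differential of [F]. *)
Lemma vertical_coord_cotangent_lift (n : vector_field R)
    (F : 'rV[R]_3 -> 'rV[R]_3) (f : 'rV[R]_3 * 'cV[R]_3) :
  'J F f.1 \in unitmx -> n f.1 *m 'J F f.1 = n (F f.1) ->
  vertical_coord n (cotangent_lift F f) = vertical_coord n f.
Proof.
by move=> JU nF; rewrite /vertical_coord /pairing /= -nF mulmxA mulmxK.
Qed.

Lemma vertical_part_lift_flow s (f : 'rV[R]_3 * 'cV[R]_3) :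
  let f' := cotangent_lift (tb_flow s) f in
  [/\ h1 f' = h1 f, h2 f' = h2 f & h3 f' = h3 f].
Proof.
by split; apply: vertical_coord_cotangent_lift; rewrite jacobian_tb_flow;
  [exact: shear_unit | exact: shear_n1 | exact: shear_unit | exact: shear_n2
  | exact: shear_unit | exact: shear_n3].
Qed.

End Flow.

(** * Transport of extremals *)

Lemma has_deriv_inDZ {R : realType} (J : interval R) (f g : R -> R)
    (c k t df dg : R) :
  has_deriv_in J f t df -> has_deriv_in J g t dg ->
  has_deriv_in J (fun u => f u + c * g u + k) t (df + c * dg).
Proof.
move=> fd gd; rewrite /has_deriv_in.
under eq_fun => u.
  rewrite (_ : _ / _ = (f u - f t) / (u - t) + c * ((g u - g t) / (u - t)));
    last by ring.
  over.
by apply: cvgD fd _; apply: cvgM gd; exact: cvg_cst.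
Qed.

Lemma has_deriv_in_addr {R : realType} (J : interval R) (f : R -> R) (k t df : R) :
  has_deriv_in J f t df -> has_deriv_in J (fun u => f u + k) t df.
Proof.
rewrite /has_deriv_in; apply: cvg_trans; apply: near_eq_cvg.
by apply: nearW => u; rewrite opprD addrACA subrr addr0.
Qed.

Theorem proposition4p3 (R : realType) (b1 b2 b3 s : R)
    (J : interval R) (hJ : 0 \in J)
    (lam : R -> cotangent R) (hlam : local_extremal J lam)
    (hlam0 : horizontal_part (lam 0) = vec3 0 0 0) :
  let mu := fun t => cotangent_lift (flow (tb b1 b2 b3) s) (lam t) in
  [/\ local_extremal J mu,
      forall t, t \in J -> vertical_part (mu t) = vertical_part (lam t),
      local_minimizer J (fun t => horizontal_part (mu t)) &
      horizontal_part (mu 0) =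
        vec3 (b1 * s) (2^-1 * b2 * b1 * s ^+ 2 + b3 * s) (b2 * s)].
Proof.
move=> mu; rewrite {}/mu flow_tb; set mu := fun t => _.
have h1mu t : h1 (mu t) = h1 (lam t).
  by case: (vertical_part_lift_flow R b1 b2 b3 s (lam t)).
have h2mu t : h2 (mu t) = h2 (lam t).
  by case: (vertical_part_lift_flow R b1 b2 b3 s (lam t)).
have h3mu t : h3 (mu t) = h3 (lam t).
  by case: (vertical_part_lift_flow R b1 b2 b3 s (lam t)).
have extmu : local_extremal J mu.
  move=> t tJ f; rewrite {}/f; have /= [[dh1 dh2 dh3] [dx dy dth]] := hlam t tJ.
  rewrite h1mu h2mu h3mu; split; split.
  - by under eq_fun do rewrite h1mu.
  - by under eq_fun do rewrite h2mu.
  - by under eq_fun do rewrite h3mu.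
  - under eq_fun do rewrite tb_flowE xco_vec3.
    exact: has_deriv_in_addr.
  (* the shear of y by b2 s x contributes b2 s h2, as does the shift of theta *)
  - under eq_fun do rewrite tb_flowE yco_vec3.
    rewrite tb_flowE thetaco_vec3 mulrDl.
    exact: has_deriv_inDZ.
  - under eq_fun do rewrite tb_flowE thetaco_vec3.
    exact: has_deriv_in_addr.
split=> //.
- by move=> t _; rewrite /vertical_part h1mu h2mu h3mu.
- by exists mu.
- rewrite [LHS]tb_flowE -/(horizontal_part (lam 0)) hlam0 xco_vec3 yco_vec3 thetaco_vec3.
  by congr vec3; ring.
Qed.
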